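(* Let $g$ be a (nonnegative) radially decreasing function in $\mathbb{R}^n$. Then for $2<p<\infty$, \[ \|M_{\nu_n}g\|_{L^{p,\infty}(\nu_n)}^\ast \leq 2^{1/p}\,\frac{5p-2}{p-2}\,\|g\|_{L^p(\nu_n)} \] and \[ \|M_{\nu_n}g\|_{L^p(\nu_n)}\leq 2^{1/p}\,\frac{5p-2}{p-2}\,\|g\|_{L^p(\nu_n)}. \]
   Context: $B(x,R)$ denotes the Euclidean ball in $\mathbb{R}^n$ centred at $x$ with radius $R$. $\nu_n$ is Lebesgue measure restricted to the Euclidean unit ball of $\mathbb{R}^n$ centred at the origin. The maximal function associated to a Radon measure $\mu$ is \[ M_\mu g(x)=\sup_{R>0,\ \mu(B(x,R))>0}\frac1{\mu(B(x,R))}\int_{B(x,R)}|g(y)|\,d\mu(y). \] A radially decreasing function is one of the form $g(x)=g_0(|x|)$ with $g_0:[0,\infty)\to[0,\infty]$ non-increasing and finite on $(0,\infty)$. The weak $L^p$ quasinorm is $\|f\|_{L^{p,\infty}(\mu)}^\ast=\sup_{\lambda>0}\lambda\,\mu(\{|f|>\lambda\})^{1/p}$. *)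

(* Defs.v *)
From HB Require Import structures.
From mathcomp Require Import all_boot all_order all_algebra.
From mathcomp Require Import all_classical all_reals all_analysis.
From mathcomp Require Import measurable_realfun.

Set Implicit Arguments.
Unset Strict Implicit.
Unset Printing Implicit Defensive.
Import Order.TTheory GRing.Theory Num.Theory.
Import numFieldNormedType.Exports.
Local Open Scope classical_set_scope.
Local Open Scope ring_scope.

(* R^n is n.-tuple R with its library sigma-algebra, the product of the Borel
   ones.  The norm and distance are Euclidean; balls are open, which makes no
   difference below as Lebesgue measure does not charge spheres. *)
Section euclidean.
Variables (R : realType) (n : nat).
Implicit Types x y : n.-tuple R.

Definition enorm x : R := Num.sqrt (\sum_(i < n) tnth x i ^+ 2).

Definition edist x y : R := Num.sqrt (\sum_(i < n) (tnth x i - tnth y i) ^+ 2).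

Definition eball x (r : R) : set (n.-tuple R) := [set y | edist x y < r].

Definition origin : n.-tuple R := [tuple 0 | _ < n].

Lemma edist_origin x : edist origin x = enorm x.
Proof.
by congr Num.sqrt; apply: eq_bigr => i _; rewrite tnth_mktuple sub0r sqrrN.
Qed.

Lemma measurable_eball x r : measurable (eball x r).
Proof.
have mf : measurable_fun setT (edist x).
  apply: (@measurableT_comp _ _ _ _ _ _ (@Num.sqrt R)).
    exact: continuous_measurable_fun (@sqrt_continuous R).
  apply: measurable_sum => i; apply: measurable_funX.
  apply: measurable_funB => //; exact: measurable_tnth.
rewrite [X in measurable X](_ : _ = setT `&` edist x @^-1` `]-oo, r[).
  exact: mf.
by rewrite setTI; apply/seteqP; split => y /=; rewrite in_itv.
Qed.

End euclidean.

Section lebesgue_Rn.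
Variable R : realType.

Definition consT n (z : measurableTypeR R * n.-tuple R) : n.+1.-tuple R := cons_tuple z.1 z.2.

Definition unconsT n (x : n.+1.-tuple R) : measurableTypeR R * n.-tuple R :=
  (thead x, behead_tuple x).

Lemma consTK n : cancel (@consT n) (@unconsT n).
Proof. by case=> t x; congr pair => //; apply/val_inj. Qed.

Lemma measurable_consT n : measurable_fun setT (@consT n).
Proof. exact: (@measurable_cons _ _ (measurableTypeR R * n.-tuple R)%type R fst n snd). Qed.

Lemma measurable_unconsT n : measurable_fun setT (@unconsT n).
Proof.
apply/measurable_fun_pairP; split; first exact: measurable_tnth.
exact: measurable_behead.
Qed.

Section lebesgue_cons.
Variables (n : nat) (m : {sigma_finite_measure set (n.-tuple R) -> \bar R}).

Definition lebesgue_cons : set (n.+1.-tuple R) -> \bar R :=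
  pushforward (lebesgue_measure \x m)%E (@consT n).

Let mpre A : measurable A -> measurable (@consT n @^-1` A).
Proof.
by move=> mA; rewrite -[X in measurable X]setTI; exact: measurable_consT.
Qed.

Let lebesgue_cons0 : lebesgue_cons set0 = 0%E.
Proof. by rewrite /lebesgue_cons /pushforward preimage_set0 measure0. Qed.

Let lebesgue_cons_ge0 A : (0 <= lebesgue_cons A)%E.
Proof. by rewrite /lebesgue_cons /pushforward measure_ge0. Qed.

Let lebesgue_cons_sigma_additive : semi_sigma_additive lebesgue_cons.
Proof.
move=> F mF tF mUF; rewrite /lebesgue_cons /pushforward preimage_bigcup.
apply: measure_semi_sigma_additive.
- by move=> k; exact: mpre.
- apply/trivIsetP => /= i j _ _ ij; rewrite -preimage_setI.
  by move/trivIsetP : tF => /(_ _ _ _ _ ij) ->//; rewrite preimage_set0.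
- by rewrite -preimage_bigcup; exact: mpre.
Qed.

HB.instance Definition _ := isMeasure.Build _ _ _ lebesgue_cons
  lebesgue_cons0 lebesgue_cons_ge0 lebesgue_cons_sigma_additive.

Let lebesgue_cons_sigma_finite : sigma_finite setT lebesgue_cons.
Proof.
have /sigma_finiteP[F [TF ndF Foo]] := sigma_finiteT (@lebesgue_measure R).
have /sigma_finiteP[G [TG ndG Goo]] := sigma_finiteT m.
exists (fun k => @unconsT n @^-1` (F k `*` G k)).
  rewrite -preimage_bigcup -[LHS](preimage_setT (@unconsT n)); congr (_ @^-1` _).
  apply/seteqP; split=> // -[x y] _.
  have [i _ Fix] : (\bigcup_i F i) x by rewrite -TF.
  have [j _ Gjy] : (\bigcup_i G i) y by rewrite -TG.
  exists (maxn i j) => //; split.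
  - by move: x Fix; exact/subsetPset/ndF/leq_maxl.
  - by move: y Gjy; exact/subsetPset/ndG/leq_maxr.
move=> k; have [mF Fk] := Foo k; have [mG Gk] := Goo k.
split.
  rewrite -[X in measurable X]setTI; apply: measurable_unconsT => //.
  exact: measurableX.
rewrite /lebesgue_cons /pushforward -comp_preimage.
rewrite (_ : _ \o _ = id); last by apply/funext => z /=; rewrite consTK.
by rewrite preimage_id product_measure1E// lte_mul_pinfty// ge0_fin_numE.
Qed.

HB.instance Definition _ := Measure_isSigmaFinite.Build _ _ _ lebesgue_cons
  lebesgue_cons_sigma_finite.

End lebesgue_cons.

(* the n-fold product of one-dimensional Lebesgue measure, see lebesgue_Rn_box *)
Fixpoint lebesgue_Rn n : {sigma_finite_measure set (n.-tuple R) -> \bar R} :=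
  match n with
  | 0 => \d_(origin R 0)
  | n'.+1 => lebesgue_cons (lebesgue_Rn n')
  end.

Lemma lebesgue_Rn_box n (A : 'I_n -> set R) : (forall i, measurable (A i)) ->
  lebesgue_Rn n [set x | forall i, A i (tnth x i)] =
  (\prod_(i < n) lebesgue_measure (A i))%E.
Proof.
elim: n A => [|n IHn] A mA.
  by rewrite big_ord0 /= diracE mem_set// => -[].
rewrite big_ord_recl -IHn//= /lebesgue_cons /pushforward.
rewrite -product_measure1E//.
  congr (_ _); apply/seteqP; split => -[t x] /=.
    move=> Ax; split=> [|i]; first exact: (Ax ord0).
    by have := Ax (lift ord0 i); rewrite tnthS.
  case=> At Ax i; case: (unliftP ord0 i) => [j ->|->//].
  by rewrite tnthS.
  exact: mA.
rewrite [X in measurable X](_ : _ = \bigcap_(i in [set: 'I_n])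
  (setT `&` (@tnth n R ^~ i) @^-1` A (lift ord0 i))).
  apply: fin_bigcap_measurable => // i _.
  exact: measurable_tnth.
apply/seteqP; split => x /= Ax i; first by split.
by have [] := Ax i Logic.I.
Qed.

Definition nu n : {measure set (n.-tuple R) -> \bar R} :=
  mrestr (lebesgue_Rn n) (measurable_eball (origin R n) 1).

End lebesgue_Rn.

Section maximal.
Variables (R : realType) (n : nat).
Implicit Types (mu : {measure set (n.-tuple R) -> \bar R})
  (g : n.-tuple R -> \bar R).
Local Open Scope ereal_scope.

(* The inverse is that of \bar R; 0 < mu (eball x r) rules out 0^-1 = +oo. *)
Definition maximal mu g (x : n.-tuple R) : \bar R :=
  ereal_sup [set (mu (eball x r))^-1 * \int[mu]_(y in eball x r) `|g y|
            | r in [set r : R | (0 < r)%R /\ 0 < mu (eball x r)]].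

Definition weakLnorm mu (p : R) g : \bar R :=
  ereal_sup [set l%:E * (mu [set x | l%:E < `|g x|]) `^ p^-1
            | l in [set l : R | (0 < l)%R]].

(* g0 is constrained on [0, +oo[ only; g0 0 may be +oo. *)
Definition radially_decreasing g : Prop :=
  exists g0 : R -> \bar R,
    [/\ forall r, (0 <= r)%R -> 0 <= g0 r,
        forall r s, (0 <= r)%R -> (r <= s)%R -> g0 s <= g0 r,
        forall r, (0 < r)%R -> g0 r \is a fin_num
      & forall x, g x = g0 (enorm x)].

End maximal.

(* Main.v *)
Require Import Defs.
From HB Require Import structures.
From mathcomp Require Import all_boot all_order all_algebra.
From mathcomp Require Import all_classical all_reals all_analysis.
From mathcomp Require Import measurable_realfun ring lra.
Set Implicit Arguments.
Unset Strict Implicit.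
Unset Printing Implicit Defensive.
Import Order.TTheory GRing.Theory Num.Theory.
Import numFieldNormedType.Exports.
Local Open Scope classical_set_scope.
Local Open Scope ring_scope.

(* Put rho = sqrt (r / |x|) <= 1.  The homothety z |-> z / rho + (1 - rho) x
   maps B(x,R) `&` B(0,r) into B(x,R) `&` B(0,|x|): with w the image of z,
   |x - w|^2 = |x - z|^2 - (1 - rho^2) (|x|^2 - |z|^2 / rho^2).  Hence
   nu (B(x,R) `&` B(0,r)) <= (r / |x|)^(n/2) nu (B(x,R)) for every R.
   Splitting B(x,R) into the shells of radii c_k |x|, c_k = 4^(-k/n), on which
   a radially decreasing g is at most g (c_k x), yields the pointwise bound
   M g (x) <= \sum_k 2 * 2^-k * g (c_k x).  Since x |-> g (c_k x) has L^p norm at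
   most 4^(k/p) |g|_p, Minkowski's inequality sums to a geometric series of
   ratio 4^(1/p) / 2, which is < 1 exactly when p > 2, and gives the constant
   4p / (p - 2).  The weak bound follows by Markov's inequality. *)

(** * Affine change of variables on the line *)

Lemma measurable_aff1 (R : realType) (c b : R) :
  measurable_fun setT (fun t : measurableTypeR R => (c * t + b : measurableTypeR R)).
Proof. by apply: measurable_funD => //; apply: measurable_funM. Qed.

(** By uniqueness of Lebesgue measure: [c] times its pushforward under [t |-> c * t + b] gives
    half-open intervals their length. *)
Lemma lebesgue_measure_aff1 (R : realType) (c b : R) (A : set R) : 0 < c ->
  measurable A ->
  (lebesgue_measure ((fun t => c * t + b)%R @^-1` A) =
   (c^-1)%:E * lebesgue_measure A)%E.
Proof.
move=> c0 mA; pose f (t : measurableTypeR R) : measurableTypeR R := c * t + b.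
have mf : measurable_fun setT f by exact: measurable_aff1.
have mE mf' : lebesgue_measure A =
    mscale (NngNum (ltW c0))
      (@measure_function_pushforward__canonical__measure_function_Measure
         _ _ _ _ _ lebesgue_measure f mf') A.
  apply: lebesgue_measure_unique => // X [[u v] _ <-] /=; rewrite /mscale /= /pushforward.
  rewrite (_ : _ @^-1` _ = `](u - b) / c, (v - b) / c]%classic); last first.
    apply/seteqP; split => t /=; rewrite !in_itv/= /f.
      by rewrite ltr_pdivrMr// ler_pdivlMr// ltrBlDr lerBrDr mulrC.
    by rewrite ltr_pdivrMr// ler_pdivlMr// ltrBlDr lerBrDr mulrC.
  rewrite !lebesgue_measure_itv/= !lte_fin ltr_pM2r ?invr_gt0// ltrD2r.
  case: ifPn => _; last by rewrite mule0.
  rewrite -!EFinB -EFinM; congr EFin; field; exact: lt0r_neq0.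
by rewrite (mE mf) /mscale/= muleA -EFinM mulVf ?mul1e// gt_eqF.
Qed.

Lemma ge0_integral_lebesgue_aff1 (R : realType) (c b : R) (h : measurableTypeR R -> \bar R) :
  0 < c -> measurable_fun setT h -> (forall t, 0 <= h t)%E ->
  (\int[lebesgue_measure]_t h (c * t + b)%R =
   (c^-1)%:E * \int[lebesgue_measure]_t h t)%E.
Proof.
move=> c0 mh h0; pose f (t : measurableTypeR R) : measurableTypeR R := c * t + b.
have mf : measurable_fun setT f by exact: measurable_aff1.
have ci : 0 <= c^-1 by rewrite invr_ge0 ltW.
rewrite -(@ge0_integral_mscale _ _ _ lebesgue_measure _ measurableT (NngNum ci) h)//.
transitivity (\int[pushforward lebesgue_measure f]_t h t)%E.
  by rewrite (ge0_integral_pushforward mf)// preimage_setT.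
apply: eq_measure_integral => A mA _; exact: lebesgue_measure_aff1.
Qed.

(** * Homotheties and translations of R^n *)

Section affine.
Variable R : realType.

Definition aff n (c : R) (b x : n.-tuple R) : n.-tuple R :=
  [tuple c * tnth x i + tnth b i | i < n].

Lemma measurable_aff n c (b : n.-tuple R) : measurable_fun setT (aff c b).
Proof.
apply/measurable_fun_tnthP => i.
rewrite (_ : _ \o _ = fun x => c * tnth x i + tnth b i); last first.
  by apply/funext => x /=; rewrite tnth_mktuple.
apply: measurable_funD => //; apply: measurable_funM => //.
exact: measurable_tnth.
Qed.

Lemma aff_consT n c (b : n.+1.-tuple R) t (x : n.-tuple R) :
  aff c b (consT (t, x)) = consT (c * t + thead b, aff c (behead_tuple b) x).
Proof.
apply: eq_from_tnth => i; rewrite tnth_mktuple.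
case: (unliftP ord0 i) => [j ->|->//].
rewrite !tnthS tnth_mktuple tnth_behead /=; congr (_ + tnth b _).
by apply: val_inj; rewrite /= inordK // ltnS; exact: (ltn_ord j).
Qed.

(** Induction on the dimension, slicing along the first coordinate: the slices contribute [c ^- n]
    by induction, and the substitution in the first coordinate contributes the last [c^-1]. *)
Lemma lebesgue_Rn_aff n c (b : n.-tuple R) (A : set (n.-tuple R)) : 0 < c ->
  measurable A ->
  (lebesgue_Rn R n (aff c b @^-1` A) = (c ^- n)%:E * lebesgue_Rn R n A)%E.
Proof.
move=> c0; elim: n b A => [|n IHn] b A mA.
  rewrite expr0 invr1 mul1e; congr (_ _); apply/funext => x /=.
  by rewrite (tuple0 (aff c b x)) (tuple0 x).
have mA' : measurable (@consT R n @^-1` A).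
  by rewrite -[X in measurable X]setTI; exact: measurable_consT.
pose h (t : measurableTypeR R) := lebesgue_Rn R n (xsection (@consT R n @^-1` A) t).
have mh : measurable_fun setT h by exact: (measurable_fun_xsection (lebesgue_Rn R n) mA').
(* The slice of the preimage at [t] is the preimage of the slice of [A] at [c * t + thead b]. *)
transitivity (\int[lebesgue_measure]_t ((c ^- n)%:E * h (c * t + thead b)%R))%E.
  rewrite /= /lebesgue_cons /pushforward /product_measure1.
  congr integral; apply/funext => t; rewrite /h -(IHn (behead_tuple b)); last first.
    exact: measurable_xsection.
  rewrite /=; congr (lebesgue_Rn R n _); apply/seteqP; split => x /=.
    by move=> /xsectionP/=; rewrite aff_consT => H; apply/xsectionP.
  by move=> /xsectionP H; apply/xsectionP => /=; rewrite aff_consT.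
rewrite ge0_integralZl//; last first.
- by rewrite lee_fin invr_ge0 exprn_ge0// ltW.
- apply: (measurableT_comp mh); exact: measurable_aff1.
rewrite (ge0_integral_lebesgue_aff1 (thead b) c0 mh)// muleA -EFinM.
by rewrite exprS invfM mulrC.
Qed.

End affine.

(** * Balls, homotheties and the measure [nu] *)

Section geometry.
Variables (R : realType) (n : nat).
Implicit Types (x y z : n.-tuple R) (c r : R).

Lemma enorm_ge0 x : 0 <= enorm x.
Proof. exact: sqrtr_ge0. Qed.

Lemma enorm_sqr x : enorm x ^+ 2 = \sum_(i < n) tnth x i ^+ 2.
Proof. by rewrite sqr_sqrtr// sumr_ge0// => i _; exact: sqr_ge0. Qed.

Lemma edist_sqr x y : Defs.edist x y ^+ 2 = \sum_(i < n) (tnth x i - tnth y i) ^+ 2.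
Proof. by rewrite sqr_sqrtr// sumr_ge0// => i _; exact: sqr_ge0. Qed.

Lemma enorm_eq0 x : enorm x = 0 -> x = origin R n.
Proof.
move=> x0; have := enorm_sqr x; rewrite x0 expr0n/= => /esym/eqP.
rewrite psumr_eq0 => [/allP h|i _]; last exact: sqr_ge0.
apply: eq_from_tnth => i; rewrite tnth_mktuple.
by apply/eqP; rewrite -sqrf_eq0; exact: (h i (mem_index_enum i)).
Qed.

Lemma enorm_aff0 c x : 0 <= c -> enorm (aff c (origin R n) x) = c * enorm x.
Proof.
move=> c0; apply/eqP; rewrite -(@eqrXn2 _ 2) ?enorm_ge0 ?mulr_ge0 ?enorm_ge0//.
rewrite exprMn !enorm_sqr mulr_sumr; apply/eqP/eq_bigr => i _.
by rewrite !tnth_mktuple addr0 exprMn.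
Qed.

Lemma homothety_subset rho r x : 0 < rho -> rho <= 1 -> enorm x < 1 ->
  eball x r `&` eball (origin R n) (rho ^+ 2 * enorm x) `<=`
  aff rho^-1 (aff (1 - rho) (origin R n) x) @^-1`
    (eball x r `&` eball (origin R n) 1).
Proof.
move=> rho0 rho1 x1 z [xz]; rewrite /eball/= !edist_origin => z0.
set w := aff _ _ _.
have wE i : tnth w i = rho^-1 * tnth z i + (1 - rho) * tnth x i.
  by rewrite !tnth_mktuple addr0.
have Z : enorm z ^+ 2 <= rho ^+ 4 * enorm x ^+ 2.
  rewrite -[4%N]/(2 * 2)%N exprM -exprMn lerXn2r ?nnegrE ?enorm_ge0//.
    by rewrite mulr_ge0 ?enorm_ge0// exprn_ge0// ltW.
  exact: ltW.
have X0 : 0 <= enorm x ^+ 2 by exact: sqr_ge0.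
have rho2 : 0 <= 1 - rho ^+ 2 by rewrite subr_ge0 expr_le1// ltW.
split.
  apply: le_lt_trans xz.
  rewrite -(@ler_pXn2r _ 2) ?nnegrE ?sqrtr_ge0// !edist_sqr.
  (* As x_i - w_i = rho x_i - z_i / rho, the cross term is -2 x_i z_i, the same as in (x_i - z_i)^2,
     so the two squares differ only by multiples of z_i^2 and x_i^2. *)
  rewrite (eq_bigr (fun i => (tnth x i - tnth z i) ^+ 2 +
     ((rho ^- 2 - 1) * tnth z i ^+ 2 - (1 - rho ^+ 2) * tnth x i ^+ 2))); last first.
    by move=> i _; rewrite wE; field; exact: lt0r_neq0.
  rewrite big_split/= sumrB -!mulr_sumr -!enorm_sqr gerDl subr_le0.
  have -> : rho ^- 2 - 1 = (1 - rho ^+ 2) * rho ^- 2.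
    by field; exact: lt0r_neq0.
  rewrite -mulrA ler_wpM2l// ler_pdivrMl ?exprn_gt0//.
  apply: (le_trans Z); rewrite ler_wpM2r//.
  by rewrite -[4%N]/(2 + 2)%N exprD ler_piMl ?expr_le1 ?exprn_ge0// ltW.
apply: le_lt_trans x1.
rewrite -(@ler_pXn2r _ 2) ?nnegrE ?enorm_ge0//.
(* Convexity of the square: w is the convex combination, with weights rho and 1 - rho, of z / rho^2
   and x, and |z / rho^2| <= |x|. *)
apply: (@le_trans _ _ (rho ^- 3 * enorm z ^+ 2 + (1 - rho) * enorm x ^+ 2)).
  rewrite !enorm_sqr !mulr_sumr -big_split/= ler_sum// => i _; rewrite wE.
  rewrite -subr_ge0; have -> : rho ^- 3 * tnth z i ^+ 2 + (1 - rho) * tnth x i ^+ 2 -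
    (rho^-1 * tnth z i + (1 - rho) * tnth x i) ^+ 2 =
    rho * (1 - rho) * (rho ^- 2 * tnth z i - tnth x i) ^+ 2.
    by field; exact: lt0r_neq0.
  by rewrite mulr_ge0 ?sqr_ge0// mulr_ge0 ?subr_ge0// ltW.
rewrite -lerBrDr -{1}(mul1r (enorm x ^+ 2)) -mulrBl opprB addrCA subrr addr0.
rewrite ler_pdivrMl ?exprn_gt0//; apply: (le_trans Z).
suff -> : rho ^+ 4 * enorm x ^+ 2 = rho ^+ 3 * (rho * enorm x ^+ 2) by []. ring.
Qed.

Lemma nu_ball_shrink rho r x : 0 < rho -> enorm x < 1 ->
  (nu R n (eball x r `&` eball (origin R n) (rho ^+ 2 * enorm x)) <=
   (rho ^+ n)%:E * nu R n (eball x r))%E.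
Proof.
move=> rho0 x1; have mB z t : measurable (@eball R n z t) by exact: measurable_eball.
have [rho1|/ltW rho1] := leP rho 1; last first.
  apply: (@le_trans _ _ (nu R n (eball x r))).
    by apply: le_measure; rewrite ?inE//; exact: measurableI.
  by rewrite lee_pemull// lee_fin exprn_ege1.
have rhoV0 : 0 < rho^-1 by rewrite invr_gt0.
apply: (@le_trans _ _ (lebesgue_Rn R n (aff rho^-1 (aff (1 - rho) (origin R n) x) @^-1`
    (eball x r `&` eball (origin R n) 1)))).
  apply: le_measure; rewrite ?inE.
  - by apply: measurableI => //; exact: measurableI.
  - rewrite -[X in measurable X]setTI; apply: measurable_aff => //.
    exact: measurableI.
  - by move=> z [xz _]; exact: homothety_subset.
rewrite lebesgue_Rn_aff//; last exact: measurableI.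
by rewrite exprVn invrK.
Qed.

(** A contraction maps the unit ball into itself, so [A] may be cut down to the ball before taking
    the preimage. The part of that preimage outside the ball is lost, hence an inequality. *)
Lemma nu_scale c A : 0 < c -> c <= 1 -> measurable A ->
  (nu R n (aff c (origin R n) @^-1` A) <= (c ^- n)%:E * nu R n A)%E.
Proof.
move=> c0 c1 mA; have mB z t : measurable (@eball R n z t) by exact: measurable_eball.
have mI : measurable (A `&` eball (origin R n) 1) by exact: measurableI.
apply: le_trans (_ : lebesgue_Rn R n (aff c (origin R n) @^-1`
    (A `&` eball (origin R n) 1)) <= _)%E; last by rewrite lebesgue_Rn_aff.
apply: le_measure; rewrite ?inE.
- by apply: measurableI => //; rewrite -[X in measurable X]setTI; exact: measurable_aff.
- by rewrite -[X in measurable X]setTI; exact: measurable_aff.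
move=> x [Ax]; rewrite /eball /= edist_origin => x1; split => //=.
rewrite /eball/= edist_origin enorm_aff0 ?(ltW c0)//; apply: le_lt_trans x1.
by rewrite ler_piMl// enorm_ge0.
Qed.

Lemma measurable_box (A : 'I_n -> set R) : (forall i, measurable (A i)) ->
  measurable [set x : n.-tuple R | forall i, A i (tnth x i)].
Proof.
move=> mA; rewrite (_ : mkset _ =
    \bigcap_(i in [set: 'I_n]) (setT `&` (@tnth n R ^~ i) @^-1` A i)).
  apply: fin_bigcap_measurable => // i _; exact: measurable_tnth.
by apply/seteqP; split => x /= Ax i; [split=> //; exact: Ax|have [] := Ax i Logic.I].
Qed.

(** The unit ball lies in the cube [-1, 1]^n, whose measure is a finite product. *)
Lemma nu_lty (A : set (n.-tuple R)) : measurable A -> (nu R n A < +oo)%E.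
Proof.
move=> mA; have mB z t : measurable (@eball R n z t) by exact: measurable_eball.
pose I : set R := `[-1, 1]%classic.
pose C := [set x : n.-tuple R | forall i, I (tnth x i)].
have mI : measurable I by exact: measurable_itv.
have mC : measurable C by exact: (@measurable_box (fun=> I)).
have CE : lebesgue_Rn R n C = (\prod_(i < n) lebesgue_measure I)%E.
  exact: (@lebesgue_Rn_box R n (fun=> I)).
apply: (@le_lt_trans _ _ (lebesgue_Rn R n C)).
  apply: le_measure; rewrite ?inE//; first exact: measurableI.
  move=> x [_]; rewrite /eball/= edist_origin => x1 i.
  rewrite /I/= in_itv/= -ler_norml -(@ler_pXn2r _ 2) ?nnegrE// expr1n -normrX.
  rewrite ger0_norm ?sqr_ge0//.
  apply: (@le_trans _ _ (enorm x ^+ 2)); last by rewrite expr_le1 ?enorm_ge0 ?ltW.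
  by rewrite enorm_sqr (bigD1 i)//= lerDl sumr_ge0// => j _; exact: sqr_ge0.
rewrite CE lebesgue_measure_itv/= lte_fin ifT ?gtrN//.
rewrite (_ : (\prod_(i < n) _)%E = (\prod_(i < n) (1 - -1))%:E) ?ltry//.
by apply/esym/(@big_morph _ _ EFin 1%E *%E).
Qed.

Lemma origin_boxE :
  [set origin R n] = [set x | forall i : 'I_n, [set (0:R)] (tnth x i)].
Proof.
apply/seteqP; split => x /=; first by move=> -> i; rewrite tnth_mktuple.
by move=> x0; apply: eq_from_tnth => i; rewrite x0 tnth_mktuple.
Qed.

Lemma measurable_origin : measurable [set origin R n].
Proof.
rewrite origin_boxE; apply: (@measurable_box (fun=> [set 0])) => i.
exact: measurable_set1.
Qed.

(** This allows the origin, where [g] may be infinite, to be discarded. In dimension 0 the measure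
    is a Dirac mass there. *)
Lemma nu_origin : (0 < n)%N -> nu R n [set origin R n] = 0%E.
Proof.
move=> n0; have mO := measurable_origin.
apply/eqP; rewrite eq_le measure_ge0 andbT.
apply: (@le_trans _ _ (lebesgue_Rn R n [set origin R n])).
  by apply: le_measure; rewrite ?inE//; apply: measurableI => //; exact: measurable_eball.
rewrite origin_boxE (@lebesgue_Rn_box R n (fun=> [set 0])); last first.
  by move=> i; exact: measurable_set1.
by rewrite (bigD1 (Ordinal n0))//= lebesgue_measure_set1 mul0e.
Qed.

End geometry.

(** * Comparison of integrals and L^p norms *)

Section measure_integral.
Context d (T : measurableType d) (R : realType).
Implicit Types (mu : {measure set T -> \bar R}) (f g : T -> \bar R) (p : R).
Local Open Scope ereal_scope.

Import HBNNSimple.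

(** The integral is a supremum over simple functions below [f], whose integrals compare value by
    value. *)
Lemma ge0_le_measure_integral (m1 m2 : {measure set T -> \bar R}) f :
  (forall A, measurable A -> m1 A <= m2 A) ->
  (forall x, 0 <= f x) ->
  \int[m1]_x f x <= \int[m2]_x f x.
Proof.
move=> m12 f0; rewrite !ge0_integralTE//; apply: ge_ereal_sup => _ [h hf <-].
apply: (@le_trans _ _ (sintegral m2 h)); last first.
  by apply: ereal_sup_ubound; exists h.
rewrite !sintegralE; apply: lee_fsum => [|r _]; first exact: fimfunP.
(* A negative value is not attained by the non-negative [h], so its level set is empty. *)
have [h0|h0] := leP 0%R r; first by rewrite lee_pmul// ?lee_fin// m12.
rewrite (_ : _ @^-1` _ = set0) ?measure0//.
apply/seteqP; split => x //= hx; move: h0; rewrite -hx ltNge.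
by rewrite fun_ge0.
Qed.

Lemma ae_le_Lnorm mu p f g : (0 < p)%R -> measurable_fun setT f ->
  measurable_fun setT g -> {ae mu, forall x, `|f x| <= `|g x|} ->
  Lnorm mu p%:E f <= Lnorm mu p%:E g.
Proof.
move=> p0 mf mg fg; rewrite unlock; apply: gt0_ler_poweR.
- by rewrite invr_ge0 ltW.
- by rewrite in_itv/= leey andbT integral_ge0// => x _; exact: poweR_ge0.
- by rewrite in_itv/= leey andbT integral_ge0// => x _; exact: poweR_ge0.
have mp h : measurable_fun setT h -> measurable_fun setT (fun x : T => `|h x| `^ p).
  move=> mh; apply: (measurableT_comp (measurable_poweR p)).
  exact: measurableT_comp.
apply: ae_ge0_le_integral => //.
- by move=> x _; exact: poweR_ge0.
- exact: mp.
- by move=> x _; exact: poweR_ge0.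
- exact: mp.
move: fg; apply: filterS => x fg _; apply: gt0_ler_poweR => //; first exact: ltW.
- by rewrite in_itv/= leey andbT.
- by rewrite in_itv/= leey andbT.
Qed.

Lemma ge0_LnormZl mu p (a : R) f : (0 < p)%R -> (0 <= a)%R -> measurable_fun setT f ->
  Lnorm mu p%:E (fun x => a%:E * f x) = a%:E * Lnorm mu p%:E f.
Proof.
move=> p0 a0 mf; rewrite unlock.
under eq_integral => x _ do rewrite abseM poweRM// gee0_abs ?lee_fin//.
rewrite ge0_integralZl//; last first.
- exact: poweR_ge0.
- by move=> x _; exact: poweR_ge0.
- apply: (measurableT_comp (measurable_poweR p)).
  exact: measurableT_comp.
rewrite poweRM ?poweR_ge0//; last by rewrite integral_ge0// => x _; exact: poweR_ge0.
by rewrite -poweRrM divff ?gt_eqF// poweRe1.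
Qed.

(** Markov's inequality for the increasing function t |-> t^p, followed by a p-th root. *)
Lemma markov_Lnorm mu p f (l : R) : (0 < p)%R -> (0 < l)%R -> measurable_fun setT f ->
  l%:E * mu [set x | l%:E < `|f x|] `^ p^-1 <= Lnorm mu p%:E f.
Proof.
move=> p0 l0 mf.
have mlt : measurable [set x | l%:E < `|f x|].
  rewrite -[X in measurable X]setTI; apply: emeasurable_fun_o_infty => //.
  exact: measurableT_comp.
have mle : measurable [set x | l%:E <= `|f x|].
  rewrite -[X in measurable X]setTI; apply: emeasurable_fun_c_infty => //.
  exact: measurableT_comp.
have -> : l%:E * mu [set x | l%:E < `|f x|] `^ p^-1 =
    (l%:E `^ p * mu [set x | l%:E < `|f x|]) `^ p^-1.
  rewrite poweRM ?poweR_ge0// -poweRrM divff ?gt_eqF// poweRe1//.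
  by rewrite lee_fin ltW.
rewrite unlock; apply: gt0_ler_poweR.
- by rewrite invr_ge0 ltW.
- by rewrite in_itv/= leey andbT mule_ge0// lee_fin powR_ge0.
- by rewrite in_itv/= leey andbT integral_ge0// => x _; exact: poweR_ge0.
apply: le_trans (_ : l%:E `^ p * mu (setT `&` [set x | l%:E <= `|f x|]) <= _).
  rewrite setTI lee_wpmul2l ?poweR_ge0//; apply: le_measure; rewrite ?inE//.
  by move=> x /= /ltW.
apply: (@le_integral_comp_abse _ _ _ mu _ measurableT f l (@poweR R ^~ p)
  (measurable_poweR p)) => //.
- by move=> r _; exact: poweR_ge0.
move=> x y; rewrite !inE/= !in_itv/= !andbT => x0 y0.
by apply: gt0_ler_poweR; rewrite ?in_itv/= ?leey ?andbT ?(ltW p0).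
Qed.

(** Minkowski's inequality bounds the norms of the partial sums [S N], and monotone convergence for
    their p-th powers carries the bound to the series. *)
Lemma Lnorm_nneseries_le mu p (f : nat -> T -> R) : (1 <= p)%R ->
  (forall k, measurable_fun setT (f k)) -> (forall k x, (0 <= f k x)%R) ->
  Lnorm mu p%:E (fun x => \sum_(k <oo) (f k x)%:E) <=
  \sum_(k <oo) Lnorm mu p%:E (EFin \o f k).
Proof.
move=> p1 mf f0; have p0 : (0 < p)%R by exact: lt_le_trans p1.
have pV0 : (0 <= p^-1)%R by rewrite invr_ge0 ltW.
pose S N x := (\sum_(0 <= k < N) f k x)%R.
have mS N : measurable_fun setT (S N) by exact: measurable_sum.
have S0 N x : (0 <= S N x)%R by exact: sumr_ge0.
have ndS x : {homo S ^~ x : m n / (m <= n)%N >-> (m <= n)%R}.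
  move=> m n mn; rewrite /S (@big_cat_nat _ _ _ m 0 n)//= lerDl; exact: sumr_ge0.
have ndSp x : {homo (fun N => (S N x `^ p)%:E) : m n / (m <= n)%N >-> m <= n}.
  by move=> m n mn; rewrite lee_fin ge0_ler_powR ?nnegrE ?ndS// ltW.
set C := (X in _ <= X).
have C0 : 0 <= C by apply: nneseries_ge0 => *; exact: Lnorm_ge0.
have SC N : Lnorm mu p%:E (EFin \o S N) <= C.
  apply: (@le_trans _ _ (\sum_(0 <= k < N) Lnorm mu p%:E (EFin \o f k))); last first.
    by apply: nneseries_lim_ge => *; exact: Lnorm_ge0.
  elim: N => [|N IH].
    rewrite big_nil (_ : _ \o _ = cst 0) ?Lnorm0 ?eqe ?gt_eqF//.
    by apply/funext => x; rewrite /S /= big_nil.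
  rewrite big_nat_recr//= (_ : S N.+1 = (S N \+ f N)%R); last first.
    by apply/funext => x; rewrite /S big_nat_recr.
  by apply: (le_trans (minkowski_EFin _ _ _ _)) => //; rewrite leeD2r.
have ppow (y : \bar R) : 0 <= y -> (y `^ p) `^ p^-1 = y.
  by move=> y0; rewrite -poweRrM divff ?gt_eqF// poweRe1.
have ppow' (y : \bar R) : 0 <= y -> (y `^ p^-1) `^ p = y.
  by move=> y0; rewrite -poweRrM mulVf ?gt_eqF// poweRe1.
have itvy (y : \bar R) : 0 <= y -> y \in `[0, +oo] by move=> ?; rewrite in_itv/= leey andbT.
have F0 x : 0 <= \sum_(k <oo) (f k x)%:E by apply: nneseries_ge0 => *; rewrite lee_fin.
(* The p-th power passes through the increasing limit. For <=, each partial sum is below the p-th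
   root of the right side, hence so is their limit; >= is monotonicity. *)
have powE x : (\sum_(k <oo) (f k x)%:E) `^ p = limn (fun N => (S N x `^ p)%:E).
  have L0 : 0 <= limn (fun N => (S N x `^ p)%:E).
    apply: lime_ge; first exact: ereal_nondecreasing_is_cvgn.
    by apply: nearW => N; rewrite lee_fin powR_ge0.
  apply/eqP; rewrite eq_le; apply/andP; split.
    rewrite -[leRHS]ppow'//; apply: gt0_ler_poweR; rewrite ?itvy ?poweR_ge0//.
      exact: ltW.
    apply: lime_le; first by apply: is_cvg_nneseries => *; rewrite lee_fin.
    apply: nearW => N; rewrite sumEFin -/(S N x) -[leLHS]ppow ?lee_fin//.
    apply: gt0_ler_poweR; rewrite ?itvy ?poweR_ge0//.
    apply: lime_ge; first exact: ereal_nondecreasing_is_cvgn.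
    by near=> M; apply: ndSp; near: M; exact: nbhs_infty_ge.
  apply: lime_le; first exact: ereal_nondecreasing_is_cvgn.
  apply: nearW => N; rewrite -poweR_EFin; apply: gt0_ler_poweR.
  - exact: ltW.
  - by rewrite itvy// lee_fin.
  - by rewrite itvy.
  rewrite /S -sumEFin; apply: nneseries_lim_ge => *; by rewrite lee_fin.
(* Writing [C] as the p-th root of its p-th power reduces the claim to a comparison of integrals. *)
rewrite -[leRHS]ppow// unlock; apply: gt0_ler_poweR => //.
- by rewrite itvy// integral_ge0// => x _; exact: poweR_ge0.
- by rewrite itvy// poweR_ge0.
under eq_integral => x _ do rewrite gee0_abs// powE.
rewrite monotone_convergence//.
- apply: lime_le.
    apply: ereal_nondecreasing_is_cvgn => m n mn; apply: ge0_le_integral => //.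
    + by move=> x _; rewrite lee_fin powR_ge0.
    + by apply/measurable_EFinP; apply: (measurableT_comp (measurable_powR p)).
    + by apply/measurable_EFinP; apply: (measurableT_comp (measurable_powR p)).
    + by move=> x _; exact: ndSp.
  apply: nearW => N.
  have -> : \int[mu]_x (S N x `^ p)%:E = Lnorm mu p%:E (EFin \o S N) `^ p.
    rewrite poweR_Lnorm ?gt_eqF//; apply: eq_integral => x _ /=.
    by rewrite ger0_norm.
  by apply: gt0_ler_poweR; rewrite ?itvy ?Lnorm_ge0// ltW.
- by move=> N; apply/measurable_EFinP; apply: (measurableT_comp (measurable_powR p)).
- by move=> N x _; rewrite lee_fin powR_ge0.
Unshelve. all: by end_near. Qed.

End measure_integral.

(** * Measurability of the maximal function *)

Section maximal_measurable.
Variables (R : realType) (n : nat).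
Local Notation T := (n.-tuple R).
Local Open Scope ereal_scope.

Lemma measurable_edist : measurable_fun setT (fun z : T * T => Defs.edist z.1 z.2).
Proof.
apply: (@measurableT_comp _ _ _ _ _ _ (@Num.sqrt R)).
  exact: continuous_measurable_fun (@sqrt_continuous R).
apply: measurable_sum => i; apply: measurable_funX; apply: measurable_funB.
  by apply: (measurableT_comp (measurable_tnth i)).
by apply: (measurableT_comp (measurable_tnth i)).
Qed.

Lemma measurable_enorm : measurable_fun setT (@enorm R n).
Proof.
rewrite (_ : @enorm R n = (fun z : T * T => Defs.edist z.1 z.2) \o pair (origin R n)).
  by apply: (measurableT_comp measurable_edist).
by apply/funext => x /=; rewrite edist_origin.
Qed.

(** The superlevel sets of the profile [g0] on [0, +oo[ are intervals, by monotonicity, and [g] is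
    the profile composed with the measurable norm. *)
Lemma measurable_radially_decreasing (g : T -> \bar R) :
  radially_decreasing g -> measurable_fun setT g.
Proof.
move=> [g0 [g00 g0d _ gE]].
apply: (measurability _ (ErealGenOInfty.measurableE R)) => // _ [_ [l ->] <-].
rewrite setTI (_ : _ @^-1` _ =
    @enorm R n @^-1` [set t | (0 <= t)%R /\ l%:E < g0 t]); last first.
  apply/seteqP; split => x /=; rewrite in_itv/= andbT gE.
    by move=> lg; split => //; exact: enorm_ge0.
  by case.
rewrite -[X in measurable X]setTI; apply: measurable_enorm => //.
apply: is_interval_measurable => s t [s0 ls] [t0 lt] u /andP[su ut].
have u0 := le_trans s0 su.
by split => //; apply: (lt_le_trans lt); exact: g0d.
Qed.

(** By Tonelli's theorem: this is a partial integral of |g(y)| times the indicator of the measurable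
    set of pairs at distance less than [r]. *)
Lemma measurable_ball_integral (mu : {sigma_finite_measure set T -> \bar R})
    (g : T -> \bar R) (r : R) : measurable_fun setT g ->
  measurable_fun setT (fun x => \int[mu]_(y in eball x r) `|g y|).
Proof.
move=> mg; pose E := [set z : T * T | (Defs.edist z.1 z.2 < r)%R].
have mE : measurable E.
  rewrite (_ : E = setT `&` (fun z => Defs.edist z.1 z.2) @^-1` `]-oo, r[).
    exact: measurable_edist.
  by rewrite setTI; apply/seteqP; split => z /=; rewrite in_itv.
pose f (z : T * T) := `|g z.2| * (\1_E z)%:E.
have mf : measurable_fun setT f.
  apply: emeasurable_funM.
    by apply: measurableT_comp => //; exact: (measurableT_comp mg).
  by apply/measurable_EFinP.
rewrite (_ : (fun x => \int[mu]_(y in eball x r) `|g y|) = fubini_F mu f).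
  by apply: measurable_fun_fubini_tonelli_F => // z; rewrite mule_ge0// lee_fin.
apply/funext => x; rewrite integral_mkcond; apply: eq_integral => y _.
rewrite patchE /f indicE /=; case: ifPn => [/set_mem xy|/negP xy].
  by rewrite mem_set ?mule1.
by rewrite memNset ?mule0// => xy'; apply: xy; exact: mem_set.
Qed.

Lemma measurable_ball_measure (mu : {sigma_finite_measure set T -> \bar R}) (r : R) :
  measurable_fun setT (fun x => mu (eball x r)).
Proof.
rewrite (_ : (fun x => mu (eball x r)) = fun x => \int[mu]_(y in eball x r) `|cst 1 y|).
  exact: measurable_ball_integral.
apply/funext => x; rewrite /= normr1 integral_cst ?mul1e//; exact: measurable_eball.
Qed.

(** Continuity from below: an open ball is the increasing union of the concentric balls of radius r
    - 1/(k+1). *)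
Lemma integral_eball_gt (mu : {measure set T -> \bar R}) (g : T -> \bar R) x (r : R) (a : \bar R) :
  measurable_fun setT g -> a < \int[mu]_(y in eball x r) `|g y| ->
  exists2 s : R, (s < r)%R & a < \int[mu]_(y in eball x s) `|g y|.
Proof.
move=> mg ar; pose F k : set T := eball x (r - k.+1%:R^-1).
have ndF : nondecreasing_seq F.
  move=> k m km; apply/subsetPset => y; rewrite /F /eball/= => /lt_le_trans; apply.
  by rewrite lerB// lef_pV2 ?posrE// ler_nat.
have UF : \bigcup_i F i = eball x r.
  apply/seteqP; split => y; rewrite /F /eball/=.
    by move=> [k _ /lt_le_trans]; apply; rewrite gerBl invr_ge0.
  rewrite -subr_gt0 => /ltr_add_invr[k]; rewrite add0r => kr; exists k => //=.
  by rewrite ltrBrDr addrC -ltrBrDr.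
have mg' i : measurable_fun (F i) (fun y => `|g y|).
  by apply: measurable_funTS; exact: measurableT_comp.
have mF i : measurable (F i) by exact: measurable_eball.
have g0 i y : F i y -> 0 <= `|g y| by [].
have := @ge0_nondecreasing_set_cvg_integral _ _ _ F _ mu ndF mF mg' g0.
rewrite UF => /cvg_lim h.
apply: contrapT => hn; move: ar; rewrite ltNge -h// => /negP; apply.
apply: lime_le.
  apply/cvg_ex; exists (\int[mu]_(y in eball x r) `|g y|); rewrite -UF.
  exact: ge0_nondecreasing_set_cvg_integral.
apply: nearW => k; rewrite leNgt; apply/negP => ak; apply: hn.
by exists (r - k.+1%:R^-1)%R => //; rewrite ltrBlDr ltrDl.
Qed.

(** This turns superlevel sets of the maximal function into countable unions. The radius and the
    mass need no positivity condition on the right: on an empty or null ball both sides vanish and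
    the strict inequality fails. *)
Lemma lt_maximal (mu : {finite_measure set T -> \bar R}) (g : T -> \bar R) (l : R) x :
  measurable_fun setT g ->
  l%:E < maximal mu g x <->
  exists q : rat, l%:E * mu (eball x (ratr q)) < \int[mu]_(y in eball x (ratr q)) `|g y|.
Proof.
move=> mg; have mB s : measurable (eball x s) by exact: measurable_eball.
have B0 s : (s <= 0)%R -> eball x s = set0.
  move=> s0; apply/seteqP; split => y //; rewrite /eball/= => /lt_le_trans/(_ s0).
  by rewrite ltNge sqrtr_ge0.
have int0 s : 0 <= \int[mu]_(y in eball x s) `|g y| by exact: integral_ge0.
have muS s t : (s <= t)%R -> mu (eball x s) <= mu (eball x t).
  move=> st; apply: le_measure; rewrite ?inE// => y /lt_le_trans; exact.
have intS s t : (s <= t)%R ->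
    \int[mu]_(y in eball x s) `|g y| <= \int[mu]_(y in eball x t) `|g y|.
  move=> st; apply: ge0_subset_integral => //.
    by apply: measurable_funTS; exact: measurableT_comp.
  by move=> y /lt_le_trans; exact.
have avgE s : 0 < mu (eball x s) ->
    (l%:E < (mu (eball x s))^-1 * \int[mu]_(y in eball x s) `|g y|) =
    (l%:E * mu (eball x s) < \int[mu]_(y in eball x s) `|g y|).
  have : mu (eball x s) \is a fin_num by exact: fin_num_measure.
  case: (mu (eball x s)) => // v _; rewrite lte_fin => v0.
  by rewrite inver gt_eqF// lte_pdivlMl// muleC.
split.
  move=> /ereal_sup_gt[_ [r [/= r0 V0] <-]]; rewrite avgE// => lI.
  (* For l >= 0, shrink the radius to some s < r that keeps the integral above l mu(B(x,r)), and
     take a rational between s and r. *)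
  have [l0|l0] := leP 0%R l.
    have [s sr lIs] := integral_eball_gt mg lI.
    have [q] := rat_in_itvoo sr; rewrite in_itv/= => /andP[sq qr].
    exists q; apply: (@le_lt_trans _ _ (l%:E * mu (eball x r))).
      by rewrite lee_wpmul2l ?lee_fin// muS// ltW.
    by apply: (lt_le_trans lIs); rewrite intS// ltW.
  (* For l < 0, any rational radius above [r] works: the left side is negative and the integral is
     not. *)
  have [q] := rat_in_itvoo (ltr_pwDr ltr01 (lexx r)); rewrite in_itv/= => /andP[rq _].
  exists q; apply: (@lt_le_trans _ _ 0) => //.
  rewrite muleC -[ltRHS](mule0 l%:E) muleC lte_nmul2l ?lte_fin//.
  by rewrite (lt_le_trans V0)// muS// ltW.
move=> [q lI].
have q0 : (0 < ratr q :> R)%R.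
  rewrite ltNge; apply/negP => /B0 h; move: lI.
  by rewrite h measure0 mule0 integral_set0 ltxx.
have V0 : 0 < mu (eball x (ratr q)).
  rewrite lt0e measure_ge0 andbT; apply/negP => /eqP h; move: lI.
  rewrite h mule0 null_set_integral// ?ltxx//.
  by apply: measurable_funTS; exact: measurableT_comp.
apply: (@lt_le_trans _ _ ((mu (eball x (ratr q)))^-1 *
    \int[mu]_(y in eball x (ratr q)) `|g y|)); first by rewrite avgE.
by apply: ereal_sup_ubound; exists (ratr q).
Qed.

Lemma measurable_maximal (mu : {finite_measure set T -> \bar R}) (g : T -> \bar R) :
  measurable_fun setT g -> measurable_fun setT (maximal mu g).
Proof.
move=> mg; apply: (measurability _ (ErealGenOInfty.measurableE R)) => // _ [_ [l ->] <-].
rewrite setTI (_ : _ @^-1` _ = \bigcup_(q : rat)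
  (setT `&` [set x | l%:E * mu (eball x (ratr q)) < \int[mu]_(y in eball x (ratr q)) `|g y|])).
  apply: bigcupT_measurable_rat => q; apply: measurable_lte => //.
    by apply: emeasurable_funM => //; exact: measurable_ball_measure.
  exact: measurable_ball_integral.
apply/seteqP; split => x /=; rewrite in_itv/= andbT.
  by move=> /(lt_maximal mu l x mg)[q lq]; exists q.
by move=> [q _ [_ lq]]; apply/(lt_maximal mu l x mg); exists q.
Qed.

End maximal_measurable.

(** * The pointwise bound by a dyadic series *)

Section pointwise_bound.
Variables (R : realType) (n : nat) (g : n.-tuple R -> \bar R) (eta : R).
Hypotheses (n0 : (0 < n)%N) (hg : radially_decreasing g).
Hypotheses (eta0 : 0 < eta) (eta1 : eta < 1) (eta_n : eta ^+ n = 2^-1).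

(** This is 4^(-k/n), written as a square to match the factor rho^2 of [nu_ball_shrink] with rho =
    eta^k. *)
Let c k : R := (eta ^+ k) ^+ 2.

(** Real-valued through [fine], which loses nothing away from the origin, where [g] is finite; an
    infinite value at the origin becomes 0. *)
Definition dyadic_term k (x : n.-tuple R) : R :=
  2 * 2 ^- k * fine (g (aff (c k) (origin R n) x)).

Local Open Scope ereal_scope.

Let c_gt0 k : (0 < c k)%R. Proof. by rewrite !exprn_gt0. Qed.

(** Full balls rather than annuli, which is enough for an upper bound. The index is shifted:
    [shell s k] has radius c_(k-1) s, while [g] will be evaluated at radius c_k s. *)
Let shell (s : R) k : set (n.-tuple R) :=
  if k is j.+1 then eball (origin R n) (c j * s) else setT.

Let measurable_shell s k : measurable (shell s k).
Proof. by case: k => [|k]//=; exact: measurable_eball. Qed.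

(** With rho = eta^k the shrinking factor is eta^(kn) = 2^-k for the shell of index k + 1; the index
    shift is the source of the factor 2. *)
Let nu_shell x r k : (enorm x < 1)%R ->
  nu R n (shell (enorm x) k `&` eball x r) <= (2 * 2 ^- k)%:E * nu R n (eball x r).
Proof.
move=> x1; case: k => [|k] /=.
  by rewrite setTI lee_pemull// lee_fin expr0 invr1 mulr1 ler1n.
rewrite setIC; apply: (le_trans (nu_ball_shrink _ _ x1)); first by rewrite exprn_gt0.
rewrite -exprM mulnC exprM eta_n exprVn exprS invfM mulrA divff ?mul1r//.
Qed.

Let le_shell_series x y : (0 < enorm x)%R -> y <> origin R n ->
  g y <= \sum_(k <oo) (fine (g (aff (c k) (origin R n) x)))%:E * (\1_(shell (enorm x) k) y)%:E.
Proof.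
case: hg => g0 [g00 g0d g0f gE] x0 yo.
have y0 : (0 < enorm y)%R.
  by rewrite lt0r enorm_ge0 andbT; apply/eqP => /enorm_eq0.
have ge0 z : 0 <= g z by rewrite gE g00// enorm_ge0.
have aE k : (fine (g (aff (c k) (origin R n) x)))%:E = g0 (c k * enorm x)%R.
  by rewrite gE enorm_aff0 ?ltW// fineK// g0f// mulr_gt0.
(* The radii c_k |x| tend to 0 and |y| > 0. *)
have exk : exists k, (c k * enorm x <= enorm y)%R.
  have : (fun k => (eta ^+ 2) ^+ k)%R @ \oo --> (0:R)%R.
    by apply: cvg_expr; rewrite ger0_norm ?sqr_ge0// expr_lt1 ?ltW.
  move=> /cvgr_lt/(_ (enorm y / enorm x)%R); rewrite divr_gt0// => /(_ isT)[N _ hN].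
  exists N; rewrite -ler_pdivlMr// /c -exprM mulnC exprM; apply/ltW/hN => /=.
  exact: leqnn.
(* Minimality of [j] puts y in shell j, while c_j |x| <= |y| gives g(y) <= g(c_j x). The other terms
   are non-negative and are dropped. *)
case: (ex_minnP exk) => j jy jmin.
rewrite (@nneseriesD1 _ _ j)//; last by move=> k _; rewrite mule_ge0// lee_fin// fine_ge0.
have -> : \1_(shell (enorm x) j) y = 1%R :> R.
  rewrite indicE mem_set//; case: j jy jmin => [|j] jy jmin //=.
  rewrite /eball/= edist_origin ltNge; apply/negP => /jmin.
  by rewrite ltnn.
rewrite mule1 aE; apply: (@le_trans _ _ (g0 (c j * enorm x)%R)).
  by rewrite gE g0d// mulr_ge0// ltW.
rewrite leeDl// nneseries_ge0// => k _ _.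
by rewrite mule_ge0// lee_fin// fine_ge0.
Qed.

Lemma radially_decreasing_ge0 x : 0 <= g x.
Proof. by case: hg => g0 [g00 _ _ ->]; rewrite g00// enorm_ge0. Qed.

Lemma dyadic_term_ge0 k x : (0 <= dyadic_term k x)%R.
Proof.
by rewrite mulr_ge0 ?mulr_ge0 ?invr_ge0 ?exprn_ge0// fine_ge0// radially_decreasing_ge0.
Qed.

Lemma maximal_le_dyadic x : (0 < enorm x)%R -> (enorm x < 1)%R ->
  maximal (nu R n) g x <= \sum_(k <oo) (dyadic_term k x)%:E.
Proof.
move=> x0 x1; apply: ge_ereal_sup => _ [r [r0 V0] <-].
have mB : measurable (eball x r) by exact: measurable_eball.
have mg := measurable_radially_decreasing hg.
have ge0 := radially_decreasing_ge0.
pose a k := fine (g (aff (c k) (origin R n) x)).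
have a0 k : (0 <= a k)%R by rewrite fine_ge0.
have mt k : measurable_fun (eball x r)
    (fun y => (a k)%:E * (\1_(shell (enorm x) k) y)%:E).
  by apply: measurable_funTS; apply: measurable_funeM; exact/measurable_EFinP.
have t0 k y : 0 <= (a k)%:E * (\1_(shell (enorm x) k) y)%:E.
  by rewrite mule_ge0 ?lee_fin.
(* [le_shell_series] is integrated over the ball; it omits only the origin, a null set. *)
have h1 : \int[nu R n]_(y in eball x r) `|g y| <=
    \int[nu R n]_(y in eball x r)
      \sum_(k <oo) (a k)%:E * (\1_(shell (enorm x) k) y)%:E.
  apply: ae_ge0_le_integral => //.
  - by apply: measurable_funTS; exact: measurableT_comp.
  - by move=> y _; apply: nneseries_ge0.
  - exact: ge0_emeasurable_sum.
  exists [set origin R n]; split; [exact: measurable_origin|exact: nu_origin|].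
  move=> y /= hy; apply: contrapT => yo; apply: hy => _.
  by rewrite gee0_abs//; exact: le_shell_series.
(* Sum and integral are exchanged, and [nu_shell] bounds the mass of each shell inside the ball. *)
have h2 : \int[nu R n]_(y in eball x r)
      \sum_(k <oo) (a k)%:E * (\1_(shell (enorm x) k) y)%:E <=
    nu R n (eball x r) * \sum_(k <oo) (dyadic_term k x)%:E.
  have : nu R n (eball x r) \is a fin_num.
    by rewrite ge0_fin_numE ?nu_lty.
  move=> /fineK <-; rewrite -nneseriesZl; last by move=> k _; rewrite lee_fin dyadic_term_ge0.
  rewrite integral_nneseries//; apply: lee_nneseries => k.
    by move=> _ _; exact: integral_ge0.
  move=> _; rewrite ge0_integralZl_EFin//; last exact/measurable_EFinP.
  rewrite integral_indic// /dyadic_term.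
  rewrite -/(a k) [(2 / 2 ^+ k * a k)%R]mulrC EFinM muleCA lee_wpmul2l ?lee_fin//.
  rewrite muleC fineK ?ge0_fin_numE ?nu_lty//; exact: nu_shell.
have := le_trans h1 h2; move: V0.
have : nu R n (eball x r) \is a fin_num by rewrite ge0_fin_numE ?nu_lty.
case: (nu R n (eball x r)) => // v _; rewrite lte_fin => v0.
by rewrite inver gt_eqF// lee_pdivrMl.
Qed.

End pointwise_bound.

(** * Norms of the rescaled functions and their geometric decay *)

Lemma Lnorm_nu_scale (R : realType) n (p c : R) (f : n.-tuple R -> \bar R) :
  0 < p -> 0 < c -> c <= 1 -> measurable_fun setT f ->
  (Lnorm (nu R n) p%:E (f \o aff c (origin R n)) <=
   ((c ^- n) `^ p^-1)%:E * Lnorm (nu R n) p%:E f)%E.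
Proof.
move=> p0 c0 c1 mf; rewrite unlock.
pose H x := (`|f x| `^ p)%E.
have H0 x : (0 <= H x)%E by exact: poweR_ge0.
have mH : measurable_fun setT H.
  apply: (measurableT_comp (measurable_poweR p)); exact: measurableT_comp.
have mphi : measurable_fun setT (aff c (origin R n)) by exact: measurable_aff.
have cn0 : 0 <= c ^- n by rewrite invr_ge0 exprn_ge0// ltW.
have I0 (h : n.-tuple R -> n.-tuple R) : (0 <= \int[nu R n]_x H (h x))%E.
  by apply: integral_ge0 => x _.
rewrite -poweR_EFin -poweRM ?lee_fin ?(I0 id)//.
apply: gt0_ler_poweR.
- by rewrite invr_ge0 ltW.
- by rewrite in_itv/= leey andbT I0.
- rewrite in_itv/= leey andbT; apply: mule_ge0; last exact: (I0 id).
  by rewrite lee_fin.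
rewrite -(@ge0_integral_mscale _ _ _ (nu R n) _ measurableT (NngNum cn0) H)//.
(* By [nu_scale] the pushforward of [nu] is dominated by c^-n times [nu], and so are the
   integrals. *)
apply: le_trans (_ : \int[pushforward (nu R n) (aff c (origin R n))]_x H x <= _)%E.
  by rewrite (ge0_integral_pushforward mphi)// preimage_setT.
apply: ge0_le_measure_integral => // A mA; exact: nu_scale.
Qed.

(** Concavity of the logarithm between 2 and 1, with weights 2/p and 1 - 2/p: their weighted mean is
    1 + 2/p, and 2^(2/p) = 4^(1/p). *)
Lemma powR4_le (R : realType) (p : R) : 2 <= p -> 4 `^ p^-1 <= 1 + 2 / p.
Proof.
move=> p2; have p0 : 0 < p by exact: lt_le_trans p2.
have t0 : 0 <= 2 / p by rewrite divr_ge0// ltW.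
have t1 : 2 / p <= 1 by rewrite ler_pdivrMr// mul1r.
have := concave_ln (Itv01 t0 t1) (ltr0n R 2) ltr01.
rewrite !convRE/= ln1 mulr0 addr0 mulr1.
rewrite (_ : 2 / p * 2 + _ = 1 + 2 / p); last by rewrite /unstable.onem; ring.
have e0 : 0 < 1 + 2 / p by rewrite ltr_pwDl.
move=> h; rewrite -[leRHS]lnK ?posrE// /powR ifF ?gt_eqF// ler_expR.
apply: le_trans h; rewrite -[4%:R]/((2 * 2)%:R) natrM lnM ?posrE//.
by rewrite le_eqVlt; apply/orP; left; apply/eqP; field; exact: lt0r_neq0.
Qed.

Lemma sum_geometric_le (R : realType) (q : R) m : 0 <= q -> q < 1 ->
  \sum_(0 <= k < m) q ^+ k <= (1 - q)^-1.
Proof.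
move=> q0 q1; have q1' : 0 < 1 - q by rewrite subr_gt0.
rewrite -[leRHS]mulr1 ler_pdivlMl// big_mkord.
rewrite -(opprB q) mulNr -subrX1 opprB gerBl exprn_ge0//.
Qed.

Lemma Lnorm_dyadic_term (R : realType) n (g : n.-tuple R -> \bar R) (eta p : R) k :
  radially_decreasing g -> 0 < eta -> eta < 1 -> eta ^+ n = 2^-1 -> 0 < p ->
  (Lnorm (nu R n) p%:E (EFin \o dyadic_term g eta k) <=
   (2 * (4 `^ p^-1 / 2) ^+ k)%:E * Lnorm (nu R n) p%:E g)%E.
Proof.
move=> hg eta0 eta1 eta_n p0.
have mg := measurable_radially_decreasing hg.
have mG : measurable_fun setT (fun x => (fine (g x))%:E).
  by apply/measurable_EFinP; apply: (measurableT_comp (fine_measurable _)).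
have c0 : 0 < (eta ^+ k) ^+ 2 by rewrite !exprn_gt0.
have c1 : (eta ^+ k) ^+ 2 <= 1 by rewrite -exprM exprn_ile1// ltW.
rewrite (_ : EFin \o _ = fun x => ((2 * 2 ^- k)%:E *
    ((fun z => (fine (g z))%:E) \o aff ((eta ^+ k) ^+ 2) (origin R n)) x)%E); last first.
  by apply/funext => x; rewrite /= -EFinM.
rewrite ge0_LnormZl//; last first.
  by apply: (measurableT_comp mG); exact: measurable_aff.
have -> : 2 * (4 `^ p^-1 / 2) ^+ k = 2 * 2 ^- k * (((eta ^+ k) ^+ 2) ^- n) `^ p^-1.
  (* Here eta^n = 1/2 is used: c_k^-n = 4^k, whose p-th root competes with the weight 2^-k. *)
  have -> : ((eta ^+ k) ^+ 2) ^- n = 4 ^+ k.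
    rewrite -!exprM (_ : (_ * _)%N = (n * (2 * k))%N); last by ring.
    by rewrite exprM eta_n exprVn invrK exprM -natrX.
  by rewrite -(@powR_mulrn _ 4)// powRAC powR_mulrn ?powR_ge0// exprMn exprVn; ring.
rewrite [X in (_ <= X * _)%E]EFinM -[leRHS]muleA; apply: lee_wpmul2l.
  by rewrite lee_fin mulr_ge0// invr_ge0 exprn_ge0.
apply: (le_trans (Lnorm_nu_scale p0 c0 c1 mG)).
apply: lee_wpmul2l; first by rewrite lee_fin powR_ge0.
(* Passing to [fine] does not increase absolute values, since infinite values become 0. *)
apply: ae_le_Lnorm => //; apply: nearW => x.
by case: (g x) => //= [|]; rewrite normr0 leey.
Qed.

(** * Measurability and sign of the maximal function of [nu] *)

Section nu_maximal.
Variables (R : realType) (n : nat).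
Local Open Scope ereal_scope.

Lemma measurable_maximal_nu (g : n.-tuple R -> \bar R) :
  measurable_fun setT g -> measurable_fun setT (maximal (nu R n) g).
Proof.
have fin : fin_num_fun (nu R n) by move=> A mA; rewrite ge0_fin_numE ?nu_lty.
pose mu : {finite_measure set (n.-tuple R) -> \bar R} :=
  HB.pack (mrestr (lebesgue_Rn R n) (measurable_eball (origin R n) 1))
    (Measure_isFinite.Build _ _ _ (nu R n) fin).
exact: (@measurable_maximal _ _ mu).
Qed.

(** The ball contains the cube of half-side d = 1/(n+1), since n d^2 < 1, and this cube has positive
    measure. *)
Lemma nu_unit_ball_gt0 : 0 < nu R n (eball (origin R n) 1).
Proof.
pose d : R := (n.+1%:R^-1)%R.
have d0 : (0 < d)%R by rewrite invr_gt0.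
pose I : set R := `[(- d)%R, d]%classic.
have mI : measurable I by exact: measurable_itv.
have mB : measurable (eball (origin R n) 1) by exact: measurable_eball.
apply: (@lt_le_trans _ _ (lebesgue_Rn R n [set x | forall i, I (tnth x i)])).
  rewrite (@lebesgue_Rn_box R n (fun=> I))// lebesgue_measure_itv/= lte_fin.
  rewrite ifT ?gtrN//; elim/big_ind : _ => [|u v u0 v0|i _]; first exact: lte01.
    exact: mule_gt0.
  by rewrite -EFinB lte_fin opprK addr_gt0.
apply: le_measure; rewrite ?inE.
- exact: (@measurable_box _ _ (fun=> I)).
- exact: measurableI.
move=> x xI; suff : eball (origin R n) 1 x by [].
rewrite /eball/= edist_origin -(@ltr_pXn2r _ 2) ?nnegrE ?enorm_ge0// enorm_sqr expr1n.
apply: (@le_lt_trans _ _ (\sum_(i < n) d ^+ 2)%R).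
  apply: ler_sum => i _; have := xI i; rewrite /I/= in_itv/= -ler_norml => xd.
  by rewrite -(ger0_norm (sqr_ge0 (tnth x i))) normrX ler_pXn2r ?nnegrE// ltW.
rewrite sumr_const card_ord -mulr_natl expr2 mulrA.
apply: (@le_lt_trans _ _ (n%:R * d)%R); last by rewrite ltr_pdivrMr// mul1r ltr_nat.
by rewrite ler_piMr ?mulr_ge0 ?(ltW d0)// invf_le1// ler1n.
Qed.

(** A ball of positive mass must be exhibited, since an empty supremum is -oo. Radius 2 works
    because B(x,2) contains the unit ball. *)
Lemma maximal_nu_ge0 (g : n.-tuple R -> \bar R) x : (enorm x < 1)%R ->
  0 <= maximal (nu R n) g x.
Proof.
move=> x1.
have V0 : 0 < nu R n (eball x 2).
  apply: (lt_le_trans nu_unit_ball_gt0).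
  have mB z r : measurable (@eball R n z r) by exact: measurable_eball.
  rewrite /nu/= /mrestr setIid; apply: le_measure; rewrite ?inE//.
    exact: measurableI.
  move=> y y1; split=> //; move: y1; rewrite /eball/= edist_origin => y1.
  rewrite -(@ltr_pXn2r _ 2) ?nnegrE ?sqrtr_ge0// edist_sqr.
  (* The parallelogram inequality, which avoids the triangle inequality for the norm. *)
  apply: (@le_lt_trans _ _ (2 * enorm x ^+ 2 + 2 * enorm y ^+ 2)%R).
    rewrite !enorm_sqr !mulr_sumr -big_split/= ler_sum// => i _.
    by rewrite -subr_ge0 (_ : _ - _ = (tnth x i + tnth y i) ^+ 2)%R ?sqr_ge0//; ring.
  have xs : (enorm x ^+ 2 < 1)%R by rewrite expr_lt1 ?enorm_ge0.
  have ys : (enorm y ^+ 2 < 1)%R by rewrite expr_lt1 ?enorm_ge0.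
  by lra.
apply: (@le_trans _ _ ((nu R n (eball x 2))^-1 * \int[nu R n]_(y in eball x 2) `|g y|)).
  by rewrite mule_ge0 ?inve_ge0 ?(ltW V0)//; exact: integral_ge0.
by apply: ereal_sup_ubound; exists 2%R.
Qed.

End nu_maximal.

(** * The strong bound with constant 4p / (p - 2), and the final estimates *)

Lemma Lnorm_maximal_le (R : realType) n (g : n.-tuple R -> \bar R) (p : R) :
  (0 < n)%N -> radially_decreasing g -> 2 < p ->
  (Lnorm (nu R n) p%:E (maximal (nu R n) g) <=
   (4 * p / (p - 2))%:E * Lnorm (nu R n) p%:E g)%E.
Proof.
move=> n0 hg p2; have p0 : 0 < p by exact: lt_trans p2.
pose eta : R := 2^-1 `^ n%:R^-1.
have eta0 : 0 < eta by rewrite powR_gt0.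
have eta_n : eta ^+ n = 2^-1.
  by rewrite -powR_mulrn ?powR_ge0// -powRrM mulVf ?powRr1// pnatr_eq0 -lt0n.
have eta1 : eta < 1.
  by rewrite ltNge; apply/negP => /(exprn_ege1 n); rewrite eta_n => ?; lra.
have mg := measurable_radially_decreasing hg.
have mt k : measurable_fun setT (dyadic_term g eta k).
  apply: measurable_funM => //; apply: (measurableT_comp (fine_measurable _)) => //.
  apply: (measurableT_comp mg); exact: measurable_aff.
have t0 k x : 0 <= dyadic_term g eta k x by exact: dyadic_term_ge0.
set N := Lnorm _ _ g.
have N0 : (0 <= N)%E by exact: Lnorm_ge0.
have p20 : 0 < p - 2 by rewrite subr_gt0.
have K0 : 0 < 4 * p / (p - 2) by rewrite divr_gt0// mulr_gt0.
have [->|Noo] := eqVneq N +oo%E; first by rewrite gt0_muley ?leey// lte_fin.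
have Nfin : N \is a fin_num by rewrite ge0_fin_numE// ltey.
apply: (@le_trans _ _ (Lnorm (nu R n) p%:E
    (fun x => \sum_(k <oo) (dyadic_term g eta k x)%:E)%E)).
  apply: ae_le_Lnorm => //.
  - exact: measurable_maximal_nu.
  - apply: ge0_emeasurable_sum => [k x _ _|k _]; first by rewrite lee_fin.
    exact/measurable_EFinP.
  (* The pointwise bound holds for 0 < |x| < 1; the remaining points form this null set. *)
  exists ([set origin R n] `|` ~` eball (origin R n) 1); split.
  - by apply: measurableU; [exact: measurable_origin|apply: measurableC; exact: measurable_eball].
  - apply/eqP; rewrite eq_le measure_ge0 andbT.
    apply: (@le_trans _ _ (nu R n [set origin R n] + nu R n (~` eball (origin R n) 1)))%E.
      apply: measureU2; first exact: measurable_origin.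
      by apply: measurableC; exact: measurable_eball.
    by rewrite nu_origin// add0e /nu/= /mrestr setICl measure0.
  move=> x hx; apply: contrapT => /not_orP[/= xo /contrapT].
  rewrite /eball/= edist_origin => x1.
  have /hx// : (`|maximal (nu R n) g x| <= `|\sum_(k <oo) (dyadic_term g eta k x)%:E|)%E.
  rewrite !gee0_abs ?maximal_nu_ge0//; last first.
    by apply: nneseries_ge0 => k _ _; rewrite lee_fin.
  apply: maximal_le_dyadic => //.
  by rewrite lt0r enorm_ge0 andbT; apply/eqP => /enorm_eq0.
have p1 : 1 <= p by rewrite (le_trans _ (ltW p2))// ler1n.
apply: (le_trans (Lnorm_nneseries_le (nu R n) p1 mt t0)).
set q := 4 `^ p^-1 / 2.
have q0 : 0 <= q by rewrite divr_ge0 ?powR_ge0.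
(* From 4^(1/p) <= 1 + 2/p; it yields 2 / (1 - q) <= 4p / (p - 2). *)
have q1 : 1 - q >= (p - 2) / (2 * p).
  have := powR4_le (ltW p2); rewrite /q => h.
  have -> : (p - 2) / (2 * p) = 1 - (1 + 2 / p) / 2 by field; exact: lt0r_neq0.
  by rewrite lerB// ler_pM2r.
have q1' : q < 1.
  by rewrite -subr_gt0; apply: lt_le_trans q1; rewrite divr_gt0// mulr_gt0.
apply: lime_le; first by apply: is_cvg_nneseries => *; exact: Lnorm_ge0.
apply: nearW => m.
apply: (@le_trans _ _ (\sum_(0 <= k < m) (2 * q ^+ k)%:E * N)%E).
  by apply: lee_sum => k _; exact: Lnorm_dyadic_term.
rewrite -ge0_sume_distrl; last by move=> k _; rewrite lee_fin mulr_ge0// exprn_ge0.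
rewrite sumEFin -mulr_sumr lee_wpmul2r// lee_fin.
apply: (@le_trans _ _ (2 * (1 - q)^-1)).
  by rewrite ler_wpM2l// sum_geometric_le.
rewrite -ler_pdivlMl// -[leRHS]invrK lef_pV2 ?posrE ?subr_gt0//; last first.
  by rewrite invr_gt0 mulr_gt0// invr_gt0.
apply: le_trans q1; rewrite le_eqVlt; apply/orP; left; apply/eqP.
by field; rewrite !lt0r_neq0.
Qed.

Theorem theorem2p4 (R : realType) (n : nat) (hn : (0 < n)%N)
    (g : n.-tuple R -> \bar R) (hg : radially_decreasing g)
    (p : R) (hp : 2 < p) :
  (weakLnorm (nu R n) p (maximal (nu R n) g)
     <= (2 `^ p^-1 * ((5 * p - 2) / (p - 2)))%:E * Lnorm (nu R n) p%:E g)%E /\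
  (Lnorm (nu R n) p%:E (maximal (nu R n) g)
     <= (2 `^ p^-1 * ((5 * p - 2) / (p - 2)))%:E * Lnorm (nu R n) p%:E g)%E.
Proof.
have p0 : 0 < p by exact: lt_trans hp.
have strong : (Lnorm (nu R n) p%:E (maximal (nu R n) g)
     <= (2 `^ p^-1 * ((5 * p - 2) / (p - 2)))%:E * Lnorm (nu R n) p%:E g)%E.
  (* The constant only grows: 4p <= 5p - 2 because p > 2, and 2^(1/p) >= 1. *)
  apply: (le_trans (Lnorm_maximal_le hn hg hp)).
  apply: lee_wpmul2r; first exact: Lnorm_ge0.
  have c1 : 1 <= 2 `^ p^-1 :> R.
    by rewrite -[leLHS](@powRr0 _ 2) ler_powR ?ler1n// invr_ge0 ltW.
  rewrite lee_fin; apply: (@le_trans _ _ ((5 * p - 2) / (p - 2))).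
    by rewrite ler_pM2r ?invr_gt0 ?subr_gt0//; lra.
  by rewrite ler_peMl// divr_ge0 ?subr_ge0 ?(ltW hp)//; lra.
split => //; apply: ge_ereal_sup => _ [l /= l0 <-]; apply: le_trans strong.
apply: markov_Lnorm => //; apply: measurable_maximal_nu.
exact: measurable_radially_decreasing.
Qed.
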